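(* Let $S$ be a commutative unital ring, $\sigma\in\mathrm{Aut}(S)$ of finite order $m$, $S_0=\{s\in S:\sigma(s)=s\}$. Let $1\le k<n$ be integers, $b\in S^\times$, let $\alpha\in S$ not be a zero divisor, and let $\tau\in\mathrm{Aut}(S)$ commute with $\sigma$; put $S_0^\tau=\{s\in S_0:\tau(s)=s\}$. Then the map $G=G_{\tau,\alpha,k}:S[t;\sigma]\to\mathbb{S}_{t^n-b}$ given by $G(a)=\tau(a)$ for $a\in S$ and $G(t)=\alpha t^k$ induces a ring homomorphism leaving $S_0^\tau$ fixed if and only if $$b\in S_0^\times,\qquad k\equiv 1 \pmod m,\qquad\text{and}\qquad m\mid n.$$
   Context: Rings $S$ are commutative, associative, with $1\ne 0$. $S[t;\sigma]$ is the skew polynomial ring with $tc=\sigma(c)t$ for $c\in S$. For a monic $f\in S[t;\sigma]$ of degree $n$, every $g\in S[t;\sigma]$ can be written uniquely as $g=qf+r$ with $\deg r<n$; write $r=g \bmod_r f$. The Petit ring $\mathbb{S}_f$ is the additive group of skew polynomials of degree $<n$ with multiplication $g\circ h=gh \bmod_r f$; it is a unital, in general nonassociative, ring containing $S$ as the constants. The map ''induces a ring homomorphism'' means: there is a ring homomorphism $G:S[t;\sigma]\to\mathbb{S}_{t^n-b}$ with $G|_S=\tau$ and $G(t)=\alpha t^k$ (it is then given by $G(\sum a_it^i)=\sum\tau(a_i)(\alpha t^k)^i$). *)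

(* Defs.v *)
From HB Require Import structures.
From mathcomp Require Import all_boot all_order all_algebra.

Set Implicit Arguments.
Unset Strict Implicit.
Unset Printing Implicit Defensive.

Import GRing.Theory.
Local Open Scope ring_scope.

Lemma iter_rmorphD (S : nzRingType) (sigma : {rmorphism S -> S}) i :
  {morph iter i sigma : x y / x + y}.
Proof. by elim: i => // i IHi x y; rewrite !iterS IHi rmorphD. Qed.

Lemma iter_rmorphM (S : nzRingType) (sigma : {rmorphism S -> S}) i :
  {morph iter i sigma : x y / x * y}.
Proof. by elim: i => // i IHi x y; rewrite !iterS IHi rmorphM. Qed.

Lemma iter_rmorph0 (S : nzRingType) (sigma : {rmorphism S -> S}) i :
  iter i sigma 0 = 0.
Proof. by elim: i => // i IHi; rewrite iterS IHi rmorph0. Qed.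

Lemma iter_rmorph1 (S : nzRingType) (sigma : {rmorphism S -> S}) i :
  iter i sigma 1 = 1.
Proof. by elim: i => // i IHi; rewrite iterS IHi rmorph1. Qed.

Lemma iter_rmorph_sum (S : nzRingType) (sigma : {rmorphism S -> S}) i
    (I : Type) (r : seq I) (P : pred I) (F : I -> S) :
  iter i sigma (\sum_(j <- r | P j) F j) =
  \sum_(j <- r | P j) iter i sigma (F j).
Proof.
exact: (big_morph _ (iter_rmorphD sigma i) (iter_rmorph0 sigma i)).
Qed.

(* S[t; sigma]: the additive group {poly S}, coefficients written on the left, *)
(* with (a t^i) (c t^j) = a sigma^i(c) t^(i + j).                              *)
Definition skewpoly (S : nzRingType) (sigma : {rmorphism S -> S}) : Type :=
  {poly S}.

HB.instance Definition _ (S : nzRingType) (sigma : {rmorphism S -> S}) :=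
  GRing.Zmodule.copy (skewpoly sigma) {poly S}.

Definition skew_mul (S : nzRingType) (sigma : {rmorphism S -> S})
    (g h : skewpoly sigma) : skewpoly sigma :=
  \poly_(i < (size g + size h).-1)
    (\sum_(j < i.+1) g`_j * iter j sigma h`_(i - j)).

Fact coef_skew_mul (S : nzRingType) (sigma : {rmorphism S -> S})
    (g h : skewpoly sigma) i :
  (skew_mul g h)`_i = \sum_(j < i.+1) g`_j * iter j sigma h`_(i - j).
Proof.
rewrite /skew_mul coef_poly ltn_predRL; case: leqP => // le_gh_i1.
rewrite big1 // => j _; have [lq_g_j|lt_j_g] := leqP (size g) j.
  by rewrite nth_default ?mul0r.
rewrite [h`__]nth_default ?iter_rmorph0 ?mulr0 // leq_subRL -ltnS //.
by rewrite (leq_trans _ le_gh_i1) // ltn_add2r.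
Qed.

Fact coef_skew_mul_rev (S : nzRingType) (sigma : {rmorphism S -> S})
    (g h : skewpoly sigma) i :
  (skew_mul g h)`_i = \sum_(j < i.+1) g`_(i - j) * iter (i - j) sigma h`_j.
Proof.
rewrite coef_skew_mul (reindex_inj rev_ord_inj) /=.
by apply: eq_bigr => j _; rewrite (sub_ordK j).
Qed.

Fact skew_mulA (S : nzRingType) (sigma : {rmorphism S -> S}) :
  associative (@skew_mul S sigma).
Proof.
move=> p q r; apply/polyP=> i; rewrite coef_skew_mul coef_skew_mul_rev.
pose coef3 j k :=
  p`_j * (iter j sigma q`_(i - j - k) * iter (i - k) sigma r`_k).
transitivity (\sum_(j < i.+1) \sum_(k < i.+1 | (k <= i - j)%N) coef3 j k).
  apply: eq_bigr => /= j _; rewrite coef_skew_mul_rev iter_rmorph_sum.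
  rewrite big_distrr /= (big_ord_narrow_leq (leq_subr _ _)).
  apply: eq_bigr => k _; rewrite /coef3 /= iter_rmorphM -iterD.
  congr (_ * (_ * iter _ _ _)); have := ltn_ord k; have := ltn_ord j.
  by rewrite !ltnS => lej lek; rewrite addnBA // subnKC.
rewrite (exchange_big_dep predT) //=; apply: eq_bigr => k _.
transitivity (\sum_(j < i.+1 | (j <= i - k)%N) coef3 j k).
  apply: eq_bigl => j; rewrite -ltnS -(ltnS j) -!subSn ?leq_ord //.
  by rewrite -subn_gt0 -(subn_gt0 j) -!subnDA addnC.
rewrite (big_ord_narrow_leq (leq_subr _ _)) coef_skew_mul big_distrl /=.
by apply: eq_bigr => j _; rewrite /coef3 -!subnDA addnC mulrA.
Qed.

Fact skew_mul1l (S : nzRingType) (sigma : {rmorphism S -> S}) :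
  left_id (1%:P : skewpoly sigma) (@skew_mul S sigma).
Proof.
move=> p; apply/polyP => i; rewrite coef_skew_mul big_ord_recl subn0.
by rewrite big1 => [|j _]; rewrite coefC ?mul0r // mul1r addr0.
Qed.

Fact skew_mul1r (S : nzRingType) (sigma : {rmorphism S -> S}) :
  right_id (1%:P : skewpoly sigma) (@skew_mul S sigma).
Proof.
move=> p; apply/polyP => i; rewrite coef_skew_mul_rev big_ord_recl subn0.
rewrite big1 => [|j _]; rewrite coefC /= ?iter_rmorph0 ?mulr0 //.
by rewrite iter_rmorph1 mulr1 addr0.
Qed.

Fact skew_mulDl (S : nzRingType) (sigma : {rmorphism S -> S}) :
  left_distributive (@skew_mul S sigma) +%R.
Proof.
move=> p q r; apply/polyP=> i; rewrite coefD !coef_skew_mul -big_split.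
by apply: eq_bigr => j _; rewrite coefD mulrDl.
Qed.

Fact skew_mulDr (S : nzRingType) (sigma : {rmorphism S -> S}) :
  right_distributive (@skew_mul S sigma) +%R.
Proof.
move=> p q r; apply/polyP=> i; rewrite coefD !coef_skew_mul -big_split.
by apply: eq_bigr => j _; rewrite coefD iter_rmorphD mulrDr.
Qed.

Fact skew_oner_neq0 (S : nzRingType) (sigma : {rmorphism S -> S}) :
  (1%:P : skewpoly sigma) != 0.
Proof. exact: (oner_neq0 {poly S}). Qed.

HB.instance Definition _ (S : nzRingType) (sigma : {rmorphism S -> S}) :=
  GRing.Zmodule_isNzRing.Build (skewpoly sigma)
    (@skew_mulA S sigma) (@skew_mul1l S sigma) (@skew_mul1r S sigma)
    (@skew_mulDl S sigma) (@skew_mulDr S sigma) (@skew_oner_neq0 S sigma).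

Definition skewC (S : nzRingType) (sigma : {rmorphism S -> S}) (a : S) :
  skewpoly sigma := a%:P.

Definition skewX (S : nzRingType) (sigma : {rmorphism S -> S}) :
  skewpoly sigma := 'X.

Definition skew_monic (S : nzRingType) (sigma : {rmorphism S -> S})
  (f : skewpoly sigma) : bool := (f : {poly S}) \is monic.

Lemma coef_skewM (S : nzRingType) (sigma : {rmorphism S -> S})
    (g h : skewpoly sigma) i :
  (g * h)`_i = \sum_(j < i.+1) g`_j * iter j sigma h`_(i - j).
Proof. exact: coef_skew_mul. Qed.

Lemma coef_skewCM (S : nzRingType) (sigma : {rmorphism S -> S}) (a : S)
    (g : skewpoly sigma) i :
  (skewC sigma a * g)`_i = a * g`_i.
Proof.
rewrite coef_skewM big_ord_recl subn0 coefC /= big1 ?addr0 // => j _.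
by rewrite coefC /= mul0r.
Qed.

Lemma coef_skewXM (S : nzRingType) (sigma : {rmorphism S -> S})
    (g : skewpoly sigma) i :
  (skewX sigma * g)`_i = if i is j.+1 then sigma g`_j else 0.
Proof.
rewrite coef_skewM big_ord_recl coefX mul0r add0r; case: i => [|i].
  by rewrite big_ord0.
rewrite big_ord_recl coefX mul1r subSS subn0 /= big1 ?addr0 // => j _.
by rewrite coefX mul0r.
Qed.

Lemma skew_commute (S : nzRingType) (sigma : {rmorphism S -> S}) (c : S) :
  skewX sigma * skewC sigma c = skewC sigma (sigma c) * skewX sigma.
Proof.
apply/polyP=> i; rewrite coef_skewXM coef_skewCM coefX.
by case: i => [|[|i]]; rewrite ?mulr0 // coefC /= ?mulr1 ?rmorph0 ?mulr0.
Qed.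

Lemma coef_skewXnM (S : nzRingType) (sigma : {rmorphism S -> S})
    (g : skewpoly sigma) n i :
  (skewX sigma ^+ n * g)`_i = if (i < n)%N then 0 else iter n sigma g`_(i - n).
Proof.
elim: n i => [|n IHn] i; first by rewrite expr0 mul1r subn0.
rewrite exprS -mulrA coef_skewXM; case: i => [|i] //.
by rewrite IHn ltnS subSS; case: ifP => //; rewrite rmorph0.
Qed.

Lemma skewXnE (S : nzRingType) (sigma : {rmorphism S -> S}) n :
  skewX sigma ^+ n = ('X^n : {poly S}).
Proof.
apply/polyP=> i; rewrite -[skewX sigma ^+ n]mulr1 coef_skewXnM coefXn.
have [lt_in|le_ni] := ltnP i n; first by rewrite ltn_eqF.
rewrite coefC subn_eq0 [i == n]eqn_leq le_ni andbT.
by case: ifP; rewrite ?iter_rmorph1 ?iter_rmorph0.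
Qed.

Lemma coef_skewM_monic (S : nzRingType) (sigma : {rmorphism S -> S})
    (q f : skewpoly sigma) :
  skew_monic f -> q != 0 ->
  (q * f)`_(size q + size f).-2 = lead_coef q.
Proof.
move=> mon_f nz_q; have mon_f' : (f : {poly S}) \is monic by [].
have nz_f := monic_neq0 mon_f'.
pose dq := (size q).-1; pose df := (size f).-1.
have Eq : size q = dq.+1 by rewrite polySpred.
have Ef : size f = df.+1 by rewrite polySpred.
rewrite Eq Ef addSn addnS /= coef_skewM.
have lt_q : (dq < (dq + df).+1)%N by rewrite ltnS leq_addr.
rewrite (bigD1 (Ordinal lt_q)) //= addKn big1 ?addr0 => [|j ne_j].
  have -> : f`_df = 1 by have /monicP := mon_f'; rewrite /lead_coef Ef.
  by rewrite iter_rmorph1 mulr1 /lead_coef.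
have [lt_j|le_j] := ltnP dq j; first by rewrite nth_default ?mul0r // Eq.
rewrite [f`__]nth_default ?iter_rmorph0 ?mulr0 // Ef.
have ltj : (j < dq)%N by rewrite ltn_neqAle le_j andbT; exact: ne_j.
by rewrite ltn_subRL ltn_add2r.
Qed.

(* For monic f, skew_rem f g is the remainder r = g mod_r f in g = q f + r,    *)
(* computed by repeatedly cancelling the leading term (see skew_rem_ex and     *)
(* skew_rem_uniq); it is set to 0 when f is not monic.                         *)
Definition skew_rem_step (S : nzRingType) (sigma : {rmorphism S -> S})
    (f g : skewpoly sigma) : skewpoly sigma :=
  g - skewC sigma (lead_coef g) * skewX sigma ^+ (size g - size f) * f.

Fixpoint skew_rem_loop (S : nzRingType) (sigma : {rmorphism S -> S})
    (f : skewpoly sigma) (k : nat) (g : skewpoly sigma) : skewpoly sigma :=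
  if k is k'.+1 then
    if (size g < size f)%N then g
    else skew_rem_loop f k' (skew_rem_step f g)
  else g.

Definition skew_rem (S : nzRingType) (sigma : {rmorphism S -> S})
    (f g : skewpoly sigma) : skewpoly sigma :=
  if skew_monic f then skew_rem_loop f (size g) g else 0.

Lemma size_skew_rem_step (S : nzRingType) (sigma : {rmorphism S -> S})
    (f g : skewpoly sigma) :
  skew_monic f -> (size f <= size g)%N ->
  (size (skew_rem_step f g) <= (size g).-1)%N.
Proof.
move=> mon_f le_fg; have mon_f' : (f : {poly S}) \is monic by [].
have nz_f := monic_neq0 mon_f'.
have gt0f : (0 < size f)%N by rewrite lt0n size_poly_eq0.
apply/leq_sizeP => i le_gi; rewrite coefB -mulrA coef_skewCM coef_skewXnM.
have le_di : (size g - size f <= i)%N.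
  by apply: leq_trans le_gi; rewrite -subn1 leq_sub2l.
rewrite ltnNge le_di /=.
have [Ei|ne_i] := eqVneq i (size g).-1.
  have -> : (i - (size g - size f) = (size f).-1)%N.
    by rewrite Ei -!subn1 subnAC subKn.
  have -> : f`_(size f).-1 = 1 by have /monicP := mon_f'.
  by rewrite iter_rmorph1 mulr1 Ei /lead_coef subrr.
have lt_gi : (size g <= i)%N.
  by rewrite -(prednK (leq_trans gt0f le_fg)) ltn_neqAle eq_sym ne_i.
rewrite [g`_i]nth_default // [f`__]nth_default ?iter_rmorph0 ?mulr0 ?subrr //.
by rewrite leq_subRL // subnK.
Qed.

Lemma size_skew_rem_loop (S : nzRingType) (sigma : {rmorphism S -> S})
    (f : skewpoly sigma) k (g : skewpoly sigma) :
  skew_monic f -> (size g <= k)%N ->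
  (size (skew_rem_loop f k g) <= (size f).-1)%N.
Proof.
move=> mon_f; have mon_f' : (f : {poly S}) \is monic by [].
have gt0f : (0 < size f)%N.
  by rewrite lt0n size_poly_eq0; exact: monic_neq0.
elim: k g => [|k IHk] g; first by rewrite leqn0 => /eqP/= ->.
move=> le_g /=; case: ltnP => [lt_gf|le_fg].
  by rewrite -ltnS prednK.
apply: IHk; apply: leq_trans (size_skew_rem_step mon_f le_fg) _.
by rewrite -ltnS prednK // (leq_trans gt0f).
Qed.

Lemma size_skew_rem (S : nzRingType) (sigma : {rmorphism S -> S})
    (f g : skewpoly sigma) :
  (size (skew_rem f g) <= (size f).-1)%N.
Proof.
rewrite /skew_rem; case: ifP => mon_f; first exact: size_skew_rem_loop.
by rewrite size_poly0.
Qed.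

Lemma skew_rem_ex (S : nzRingType) (sigma : {rmorphism S -> S})
    (f g : skewpoly sigma) :
  skew_monic f -> exists q, g = q * f + skew_rem f g.
Proof.
move=> mon_f; rewrite /skew_rem mon_f.
move: (size g) => k; elim: k g => [|k IHk] h /=.
  by exists 0; rewrite mul0r add0r.
case: ltnP => _; first by exists 0; rewrite mul0r add0r.
have [q] := IHk (skew_rem_step f h); move/(canRL (subrK _)) => Eh.
exists (q + skewC sigma (lead_coef h) * skewX sigma ^+ (size h - size f)).
by rewrite [LHS]Eh mulrDl addrAC.
Qed.

Lemma skew_rem_uniq (S : nzRingType) (sigma : {rmorphism S -> S})
    (f q r : skewpoly sigma) :
  skew_monic f -> (size r < size f)%N -> skew_rem f (q * f + r) = r.
Proof.
move=> mon_f lt_rf; have mon_f' : (f : {poly S}) \is monic by [].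
have gt0f : (0 < size f)%N by apply: leq_ltn_trans lt_rf.
set g := q * f + r; have [q' Eg] := skew_rem_ex g mon_f.
have lt_r'f : (size (skew_rem f g) < size f)%N.
  by rewrite -(prednK gt0f) ltnS size_skew_rem.
pose d := q - q'; have E : d * f = skew_rem f g - r.
  by apply/eqP; rewrite /d mulrBl subr_eq addrAC -subr_eq opprK -/g addrC -Eg.
have [z|nz] := eqVneq d 0.
  by apply/eqP; rewrite -subr_eq0 -E z mul0r.
have := coef_skewM_monic mon_f nz; rewrite E.
rewrite nth_default => [/esym/eqP|].
  by rewrite lead_coef_eq0 (negPf nz).
have gt0q : (0 < size d)%N.
  by rewrite lt0n size_poly_eq0.
apply: leq_trans (size_polyD _ _) _; rewrite size_polyN geq_max.
have le_f : ((size f).-1 <= (size d + size f).-2)%N.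
  by rewrite -(prednK gt0q) addSn /= -(prednK gt0f) addnS /= leq_addl.
by apply/andP; split; apply: leq_trans le_f; rewrite -ltnS prednK.
Qed.

Lemma skew_rem_small (S : nzRingType) (sigma : {rmorphism S -> S})
    (f r : skewpoly sigma) :
  skew_monic f -> (size r < size f)%N -> skew_rem f r = r.
Proof.
by move=> mon_f lt_rf; rewrite -[X in skew_rem f X]add0r -(mul0r f)
  skew_rem_uniq.
Qed.

Lemma skew_remD (S : nzRingType) (sigma : {rmorphism S -> S})
    (f : skewpoly sigma) :
  {morph skew_rem f : g h / g + h}.
Proof.
move=> g h; have [mon_f|/negbTE nmon_f] := boolP (skew_monic f); last first.
  by rewrite /skew_rem nmon_f addr0.
have mon_f' : (f : {poly S}) \is monic by [].
have gt0f : (0 < size f)%N.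
  by rewrite lt0n size_poly_eq0; exact: monic_neq0.
have [q Eq] := skew_rem_ex g mon_f; have [q' Eq'] := skew_rem_ex h mon_f.
rewrite [in LHS]Eq [in LHS]Eq' addrACA -mulrDl skew_rem_uniq //.
apply: leq_ltn_trans (size_polyD _ _) _.
by rewrite gtn_max -(prednK gt0f) !ltnS !size_skew_rem.
Qed.

Lemma skew_monic_XnsubC (S : nzRingType) (sigma : {rmorphism S -> S}) n b :
  (0 < n)%N -> skew_monic (skewX sigma ^+ n - skewC sigma b).
Proof. by move=> gt0n; rewrite skewXnE; exact: monicXnsubC. Qed.

Lemma size_skewXnsubC (S : nzRingType) (sigma : {rmorphism S -> S}) n b :
  (0 < n)%N -> size (skewX sigma ^+ n - skewC sigma b)%R = n.+1.
Proof. by move=> gt0n; rewrite skewXnE; exact: size_XnsubC. Qed.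

(* The bound (size f).-1 is deg f, so elements have degree < deg f.            *)
Definition petit_pred (S : nzRingType) (sigma : {rmorphism S -> S})
    (f : skewpoly sigma) : {pred skewpoly sigma} :=
  fun g => (size g <= (size f).-1)%N.

Fact petit_zmod_closed (S : nzRingType) (sigma : {rmorphism S -> S})
    (f : skewpoly sigma) :
  zmod_closed (petit_pred f).
Proof.
split=> [|g h]; rewrite !unfold_in ?size_poly0 // => le_g le_h.
by apply: leq_trans (size_polyD _ _) _; rewrite size_polyN geq_max le_g.
Qed.

HB.instance Definition _ (S : nzRingType) (sigma : {rmorphism S -> S})
    (f : skewpoly sigma) :=
  GRing.isZmodClosed.Build (skewpoly sigma) (petit_pred f)
    (petit_zmod_closed f).

Record petit (S : nzRingType) (sigma : {rmorphism S -> S})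
    (f : skewpoly sigma) : Type :=
  Petit { petit_val :> skewpoly sigma; _ : petit_val \in petit_pred f }.

HB.instance Definition _ (S : nzRingType) (sigma : {rmorphism S -> S})
    (f : skewpoly sigma) := [isSub for @petit_val S sigma f].
HB.instance Definition _ (S : nzRingType) (sigma : {rmorphism S -> S})
    (f : skewpoly sigma) := [Choice of petit f by <:].
HB.instance Definition _ (S : nzRingType) (sigma : {rmorphism S -> S})
    (f : skewpoly sigma) := [SubChoice_isSubZmodule of petit f by <:].

Definition petit_mod (S : nzRingType) (sigma : {rmorphism S -> S})
    (f g : skewpoly sigma) : petit f :=
  Petit (size_skew_rem f g : skew_rem f g \in petit_pred f).

Definition petit_mul (S : nzRingType) (sigma : {rmorphism S -> S})
    (f : skewpoly sigma) (g h : petit f) : petit f :=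
  petit_mod f (petit_val g * petit_val h).

Definition petit_one (S : nzRingType) (sigma : {rmorphism S -> S})
    (f : skewpoly sigma) : petit f :=
  petit_mod f 1.

Lemma petit_mulDl (S : nzRingType) (sigma : {rmorphism S -> S})
    (f : skewpoly sigma) :
  left_distributive (@petit_mul S sigma f) +%R.
Proof. by move=> g h l; apply: val_inj; rewrite /= mulrDl skew_remD. Qed.

Lemma petit_mulDr (S : nzRingType) (sigma : {rmorphism S -> S})
    (f : skewpoly sigma) :
  right_distributive (@petit_mul S sigma f) +%R.
Proof. by move=> g h l; apply: val_inj; rewrite /= mulrDr skew_remD. Qed.

Lemma petit_mul1l (S : nzRingType) (sigma : {rmorphism S -> S})
    (f : skewpoly sigma) :
  skew_monic f -> (1 < size f)%N -> left_id (petit_one f) (@petit_mul S sigma f).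
Proof.
move=> mon_f gt1f [g le_g]; apply: val_inj => /=.
rewrite (@skew_rem_small _ _ _ 1) ?mul1r //; last by rewrite size_poly1.
by rewrite skew_rem_small // -(prednK (ltnW gt1f)) ltnS.
Qed.

Lemma petit_mul1r (S : nzRingType) (sigma : {rmorphism S -> S})
    (f : skewpoly sigma) :
  skew_monic f -> (1 < size f)%N -> right_id (petit_one f) (@petit_mul S sigma f).
Proof.
move=> mon_f gt1f [g le_g]; apply: val_inj => /=.
rewrite (@skew_rem_small _ _ _ 1) ?mulr1 //; last by rewrite size_poly1.
by rewrite skew_rem_small // -(prednK (ltnW gt1f)) ltnS.
Qed.

Definition petit_ring_hom (S : nzRingType) (sigma : {rmorphism S -> S})
    (f : skewpoly sigma) (G : skewpoly sigma -> petit f) : Prop :=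
  [/\ {morph G : g h / g + h},
      {morph G : g h / g * h >-> petit_mul g h} &
      G 1 = petit_one f].

Definition has_aut_order (S : Type) (sigma : S -> S) (m : nat) : Prop :=
  [/\ (0 < m)%N,
      iter m sigma =1 id &
      forall j, (0 < j < m)%N -> ~ iter j sigma =1 id].

Definition fixed_ring (S : nzRingType) (sigma : S -> S) : {pred S} :=
  [pred s | sigma s == s].

Definition fixed_ring2 (S : nzRingType) (sigma tau : S -> S) : {pred S} :=
  [pred s in fixed_ring sigma | tau s == s].

Definition unit_of_subring (S : comNzRingType) (A : {pred S}) (b : S) : Prop :=
  b \in A /\ exists2 c, c \in A & b * c = 1.

(* Main.v *)
(* Only one reduction matters: for r < n, t^(n + r) = sigma^r(b) t^r mod f,   *)
(* where f = t^n - b. Put u = alpha t^k.                                      *)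
(* If G exists, G(t a) = G(sigma(a) t) gives sigma^k = sigma. With i the      *)
(* least integer such that n <= i k and r = i k - n < k, the power u^i        *)
(* reduces to a regular multiple of t^r, so G(t^i a) = G(sigma^i(a) t^i)      *)
(* gives sigma^i = sigma^r; as i k = i mod m, m divides n. Finally            *)
(* G(t^i t) = G(t t^i) gives sigma(b) = b.                                    *)
(* Conversely, t |-> u and a |-> tau(a) extend to a ring endomorphism of      *)
(* S[t; sigma], and f is central, so that g |-> g mod f is multiplicative.    *)
Require Import Defs.
From mathcomp Require Import all_boot all_order all_algebra.

Set Implicit Arguments.
Unset Strict Implicit.
Unset Printing Implicit Defensive.

Import GRing.Theory.
Local Open Scope ring_scope.

(** [S[t; sigma]] is associative while the Petit ring need not be, so identities between monomials
    become conditions on coefficients once [G] is applied. Two suffice: moving a constant across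
    [t^i] ([petit_hom_mono_iter]), and moving [t] across the first power whose image wraps around
    modulo [t^n - b] ([petit_hom_X_wrap], [petit_hom_dvdn_sigma_b]). Coefficients cancel because
    [alpha] is regular and [b] a unit; [eq_iter_aut_order] turns equal iterates into congruences.
    Conversely, [sigma b = b] and [m %| n] make [t^n - b] central ([skew_central]), so reduction is
    multiplicative ([petit_modM]), while [k = 1] modulo [m] makes [alpha t^k] commute with constants
    as [t] does, so evaluation there is multiplicative ([skew_evalM]). *)

Lemma eq_iter_aut_order (T : Type) (sigma : T -> T) (m i j : nat) :
  injective sigma -> has_aut_order sigma m ->
  (iter i sigma =1 iter j sigma) <-> i = j %[mod m].
Proof.
move=> inj_s [gt0m sm min_m].
have iterM q x : iter (q * m) sigma x = x.
  by elim: q => // q IHq; rewrite mulSn iterD IHq sm.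
have iter_mod l : iter l sigma =1 iter (l %% m) sigma.
  by move=> x; rewrite {1}(divn_eq l m) iterD iterM.
have inj_iter l : injective (iter l sigma).
  by elim: l => // l IHl x y; rewrite !iterS => /inj_s /IHl.
have le_mod l l' : (l <= l')%N -> iter l' sigma =1 iter l sigma ->
    l' = l %[mod m].
  move=> le_l Es; apply/eqP; rewrite eqn_mod_dvd //; set d := (l' - l)%N.
  have sd : iter d sigma =1 id.
    by move=> x; apply: (inj_iter l); rewrite -iterD subnKC.
  rewrite /dvdn -[_ == _]negbK -lt0n; apply/negP => gt0d.
  case: (min_m (d %% m)%N); first by rewrite gt0d ltn_pmod.
  by move=> x; rewrite -iter_mod sd.
split=> [Es | Eij x]; last by rewrite iter_mod Eij -iter_mod.
have [/le_mod|/ltnW/le_mod] := leqP i j; last exact.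
by move=> Emod; apply/esym/Emod => x; rewrite Es.
Qed.

(** * Monomials and central elements of the skew polynomial ring *)

Section SkewMonomials.

Variables (S : nzRingType) (sigma : {rmorphism S -> S}).
Implicit Types (a c : S) (g h f : skewpoly sigma) (i j : nat).

Definition skew_mono a i : skewpoly sigma := skewC sigma a * skewX sigma ^+ i.

Lemma coef_skew_mono a i j : (skew_mono a i)`_j = a *+ (j == i).
Proof. by rewrite coef_skewCM skewXnE coefXn mulr_natr. Qed.

Lemma skew_mono_inj i : injective (skew_mono^~ i).
Proof.
move=> a c /(congr1 (fun g : skewpoly sigma => g`_i)).
by rewrite !coef_skew_mono eqxx.
Qed.

Lemma size_skew_mono a i : (size (skew_mono a i) <= i.+1)%N.
Proof.
apply/leq_sizeP => j lt_ij; rewrite coef_skew_mono.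
by rewrite gtn_eqF.
Qed.

Lemma skew_mono0 a : skew_mono a 0 = skewC sigma a.
Proof. by rewrite /skew_mono expr0 mulr1. Qed.

Lemma skew_mono1 i : skew_mono 1 i = skewX sigma ^+ i.
Proof. by rewrite /skew_mono (mul1r (skewX sigma ^+ i)). Qed.

Lemma skewCD a c : skewC sigma (a + c) = skewC sigma a + skewC sigma c.
Proof. exact: polyCD. Qed.

Lemma skew_monoM a c i j :
  skew_mono a i * skew_mono c j = skew_mono (a * iter i sigma c) (i + j).
Proof.
apply/polyP => l; rewrite -mulrA coef_skewCM coef_skewXnM !coef_skew_mono.
have [lt_li|le_il] := ltnP l i.
  by rewrite mulr0 ltn_eqF // ltn_addr.
rewrite -(eqn_add2l i) subnKC // .
by case: eqP => _; rewrite ?mulr1n // !mulr0n iter_rmorph0 mulr0.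
Qed.

Lemma skewCM a c : skewC sigma (a * c) = skewC sigma a * skewC sigma c.
Proof. by rewrite -!skew_mono0 skew_monoM. Qed.

Lemma skewpoly_def_leq N g :
  (size g <= N)%N -> g = \sum_(i < N) skew_mono g`_i i.
Proof.
move=> le_gN; apply/polyP => j; rewrite coef_sum.
have [lt_jN|le_Nj] := ltnP j N.
  rewrite (bigD1 (Ordinal lt_jN)) //= coef_skew_mono eqxx big1 ?addr0 // => i.
  by rewrite coef_skew_mono eq_sym -val_eqE /= => /negbTE->.
rewrite nth_default ?(leq_trans le_gN) // big1 // => i _.
by rewrite coef_skew_mono gtn_eqF // (leq_trans (ltn_ord i)).
Qed.

Lemma skewpoly_def g : g = \sum_(i < size g) skew_mono g`_i i.
Proof. exact: skewpoly_def_leq. Qed.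

Lemma skew_central f :
    (forall a, GRing.comm f (skewC sigma a)) -> GRing.comm f (skewX sigma) ->
  forall g, GRing.comm f g.
Proof.
move=> comm_fC comm_fX g; rewrite (skewpoly_def g); apply: commr_sum => i _.
by apply: commrM => //; apply: commrX.
Qed.

End SkewMonomials.

(** * Remainders, and reduction modulo [t^n - b] *)

Section SkewRemainder.

Variables (S : nzRingType) (sigma : {rmorphism S -> S}).
Implicit Types (a b : S) (f g h q : skewpoly sigma) (j n r : nat).

Lemma skew_remMDl f q g : skew_monic f -> skew_rem f (q * f + g) = skew_rem f g.
Proof.
move=> mon_f; have [q' Eg] := skew_rem_ex g mon_f.
rewrite {1}Eg addrA -mulrDl skew_rem_uniq //.
have gt0f : (0 < size f)%N by rewrite lt0n size_poly_eq0; apply: monic_neq0.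
by rewrite -(prednK gt0f) ltnS size_skew_rem.
Qed.

(** For central [f] the left multiples of [f] form a two-sided ideal, so replacing both factors by
    their remainders alters the product only by a left multiple of [f]. *)
Lemma petit_modM f g h : skew_monic f -> (forall g, GRing.comm f g) ->
  petit_mod f (g * h) = petit_mul (petit_mod f g) (petit_mod f h).
Proof.
move=> mon_f comm_f; apply: val_inj => /=.
have [q] := skew_rem_ex g mon_f; have [q'] := skew_rem_ex h mon_f.
move: (skew_rem f g) (skew_rem f h) => r r' -> ->.
rewrite mulrDl -mulrA comm_f mulrDr !mulrA -[r * q' * f]mulrA.
by rewrite !mulrA addrA -mulrDl skew_remMDl.
Qed.

Lemma skew_rem_mono_small n b a j : (0 < n)%N -> (j < n)%N ->
  skew_rem (skewX sigma ^+ n - skewC sigma b) (skew_mono sigma a j) =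
    skew_mono sigma a j.
Proof.
move=> gt0n lt_jn; apply: skew_rem_small; first exact: skew_monic_XnsubC.
by rewrite size_skewXnsubC // ltnS (leq_trans (size_skew_mono _ _ _)).
Qed.

Lemma skew_rem_mono_XnsubC n b a r : (r < n)%N ->
  skew_rem (skewX sigma ^+ n - skewC sigma b) (skew_mono sigma a (n + r)) =
    skew_mono sigma (a * iter r sigma b) r.
Proof.
move=> lt_rn; have gt0n : (0 < n)%N by apply: leq_ltn_trans lt_rn.
set f := _ - _.
have -> : skew_mono sigma a (n + r) =
    skew_mono sigma a r * f + skew_mono sigma (a * iter r sigma b) r.
  rewrite mulrBr -skew_mono0 skew_monoM addn0 subrK -skew_mono1 skew_monoM.
  by rewrite iter_rmorph1 mulr1 addnC.
by rewrite skew_remMDl ?skew_monic_XnsubC // skew_rem_mono_small.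
Qed.

End SkewRemainder.

(** * Evaluation endomorphisms of the skew polynomial ring *)

Section SkewEvaluation.

Variables (S : nzRingType) (sigma tau : {rmorphism S -> S}).
Variable u : skewpoly sigma.
(** This is the image of the defining relation [t a = sigma(a) t] under [t |-> u], [a |-> tau a]. *)
Hypothesis u_tau :
  forall a, u * skewC sigma (tau a) = skewC sigma (tau (sigma a)) * u.

Definition skew_eval (g : skewpoly sigma) : skewpoly sigma :=
  \sum_(i < size g) skewC sigma (tau g`_i) * u ^+ i.

Lemma skew_eval_leq N (g : skewpoly sigma) : (size g <= N)%N ->
  skew_eval g = \sum_(i < N) skewC sigma (tau g`_i) * u ^+ i.
Proof.
move=> le_gN; pose F i := skewC sigma (tau g`_i) * u ^+ i.
rewrite /skew_eval (big_ord_widen N F le_gN) big_mkcond /=.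
apply: eq_bigr => i _; case: ltnP => // le_gi.
by rewrite nth_default // rmorph0 /skewC polyC0 mul0r.
Qed.

Lemma skew_evalD : {morph skew_eval : g h / g + h}.
Proof.
move=> g h; pose N := maxn (size g) (size h).
rewrite !(@skew_eval_leq N) ?leq_maxl ?leq_maxr ?size_polyD // -big_split /=.
by apply: eq_bigr => i _; rewrite coefD rmorphD skewCD mulrDl.
Qed.

Lemma skew_eval0 : skew_eval 0 = 0.
Proof. by rewrite /skew_eval size_poly0 big_ord0. Qed.

Lemma skew_eval_mono a i :
  skew_eval (skew_mono sigma a i) = skewC sigma (tau a) * u ^+ i.
Proof.
rewrite (skew_eval_leq (size_skew_mono _ _ _)) big_ord_recr /= big1 => [|j _].
  by rewrite add0r coef_skew_mono eqxx.
by rewrite coef_skew_mono ltn_eqF // rmorph0 /skewC polyC0 mul0r.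
Qed.

Lemma exp_skew_commute a i :
  u ^+ i * skewC sigma (tau a) = skewC sigma (tau (iter i sigma a)) * u ^+ i.
Proof.
elim: i => [|i IHi] /=; first by rewrite expr0 mul1r mulr1.
by rewrite exprS -mulrA IHi mulrA u_tau -mulrA.
Qed.

Lemma skew_evalM : {morph skew_eval : g h / g * h}.
Proof.
have eval_sum := big_morph skew_eval skew_evalD skew_eval0.
move=> g h; rewrite (skewpoly_def g) mulr_suml !eval_sum mulr_suml.
apply: eq_bigr => i _; rewrite (skewpoly_def h) mulr_sumr !eval_sum mulr_sumr.
apply: eq_bigr => j _; rewrite skew_monoM !skew_eval_mono rmorphM skewCM exprD.
by rewrite -!mulrA; congr (_ * _); rewrite !mulrA exp_skew_commute.
Qed.

End SkewEvaluation.

(** An automorphism preserves regularity: an equation can be pulled back along its inverse and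
    cancelled there. *)
Lemma lreg_prod_iter (S : nzRingType) (sigma : {rmorphism S -> S}) alpha j :
  bijective sigma -> GRing.lreg alpha ->
  GRing.lreg (\prod_(l < j) iter l sigma alpha).
Proof.
move=> [sigma' sK s'K] reg_a; apply: big_ind => //; first exact: lreg1.
  exact: lregM.
move=> [l _] _ /=; elim: l => // l IHl x y /= E.
rewrite -[x]s'K -[y]s'K; congr (sigma _); apply: IHl; apply: (can_inj sK).
by rewrite !rmorphM !s'K.
Qed.

(** * Conditions forced by the existence of the homomorphism *)

Section PetitHomNecessity.

Variables (S : comUnitRingType) (sigma tau : {rmorphism S -> S}).
Variables (m k n : nat) (b alpha : S).
Hypotheses (sigma_bij : bijective sigma) (sigma_order : has_aut_order sigma m).
Hypotheses (k_gt0 : (1 <= k)%N) (k_lt_n : (k < n)%N).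
Hypotheses (b_unit : b \is a GRing.unit) (alpha_reg : GRing.lreg alpha).
Hypothesis tau_bij : bijective tau.
Hypothesis tau_sigma : forall s : S, tau (sigma s) = sigma (tau s).

Let f := skewX sigma ^+ n - skewC sigma b.
Let mono := skew_mono sigma.
Variable G : skewpoly sigma -> petit f.
Hypothesis G_hom : petit_ring_hom G.
Hypothesis GC : forall a, petit_val (G (skewC sigma a)) = skewC sigma (tau a).
Hypothesis GX :
  petit_val (G (skewX sigma)) = skewC sigma alpha * skewX sigma ^+ k.

Let n_gt0 : (0 < n)%N := leq_ltn_trans (leq0n k) k_lt_n.

Let GM g h : petit_val (G (g * h)) =
  skew_rem f (petit_val (G g) * petit_val (G h)).
Proof. by case: G_hom => _ -> _. Qed.

Let sigma_inj : injective sigma := bij_inj sigma_bij.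

Let tau_iter i s : tau (iter i sigma s) = iter i sigma (tau s).
Proof. by elim: i => //= i IHi; rewrite tau_sigma IHi. Qed.

(** Compare [G (t^i a)] with [G (sigma^i(a) t^i)]: both products have degree at most [r < n], so
    nothing is reduced and [c] cancels. Surjectivity of [tau] makes [tau a] an arbitrary
    constant. *)
Lemma petit_hom_mono_iter i c r : (r < n)%N -> GRing.lreg c ->
  petit_val (G (skewX sigma ^+ i)) = mono c r ->
  iter r sigma =1 iter i sigma.
Proof.
move=> lt_rn reg_c GXi s; have [tau' _ tauK] := tau_bij.
have : G (skewX sigma ^+ i * skewC sigma (tau' s)) =
       G (skewC sigma (iter i sigma (tau' s)) * skewX sigma ^+ i).
  by rewrite -skew_mono0 -skew_mono1 skew_monoM mul1r addn0 skew_mono1.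
move/(congr1 (@petit_val _ _ _)); rewrite !GM GXi !GC -!skew_mono0 !skew_monoM.
rewrite addn0 add0n !skew_rem_mono_small // => /skew_mono_inj /=.
by rewrite tau_iter tauK [RHS]mulrC => /reg_c.
Qed.


Lemma petit_hom_iter_k : iter k sigma =1 sigma.
Proof. by apply: (petit_hom_mono_iter (i := 1)) alpha_reg _. Qed.

Lemma petit_hom_modn_k : k = 1 %[mod m].
Proof.
apply/(eq_iter_aut_order k 1 sigma_inj sigma_order).
exact: petit_hom_iter_k.
Qed.

(** Since [sigma^k = sigma], this is the coefficient of [(alpha t^k)^j] before any reduction. *)
Let alphas j := \prod_(l < j) iter l sigma alpha.

Let alphas_reg j : GRing.lreg (alphas j) := lreg_prod_iter sigma_bij alpha_reg.

Let alphasSl j : alphas j.+1 = alpha * sigma (alphas j).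
Proof. by rewrite /alphas big_ord_recl rmorph_prod. Qed.

Lemma petit_hom_X_succ j c :
    petit_val (G (skewX sigma ^+ j)) = mono c (j * k) ->
  petit_val (G (skewX sigma ^+ j.+1)) =
    skew_rem f (mono (c * iter j sigma alpha) (j.+1 * k)).
Proof.
move=> GXj; rewrite exprSr GM GXj GX skew_monoM mulSnr.
have /(eq_iter_aut_order _ _ sigma_inj sigma_order)-> // : j * k = j %[mod m].
by rewrite -modnMmr petit_hom_modn_k modnMmr muln1.
Qed.

Lemma petit_hom_X_exp j : (j * k < n)%N ->
  petit_val (G (skewX sigma ^+ j)) = mono (alphas j) (j * k).
Proof.
elim: j => [|j IHj] lt_jk.
  case: G_hom => _ _ ->; rewrite /= -[1](expr0 (skewX sigma)) -skew_mono1.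
  by rewrite skew_rem_mono_small // /alphas big_ord0.
rewrite (petit_hom_X_succ (IHj _)) ?skew_rem_mono_small //.
  by rewrite /alphas big_ord_recr.
by apply: leq_ltn_trans lt_jk; rewrite leq_mul2r leqnSn orbT.
Qed.

Lemma petit_hom_X_wrap :
  exists i r, [/\ (i * k = n + r)%N, (r < k)%N &
    petit_val (G (skewX sigma ^+ i)) = mono (alphas i * iter r sigma b) r].
Proof.
(* [q] is the largest exponent with [q * k < n]; dividing [n.-1] keeps this strict when [k] divides
   [n], in which case the next power lands at [r = 0]. *)
pose q := (n.-1 %/ k)%N.
have lt_qk : (q * k < n)%N.
  by rewrite -[ltnRHS]prednK // ltnS leq_trunc_div.
have le_nqk : (n <= q.+1 * k)%N by rewrite -[leqLHS]prednK // ltn_ceil.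
have Eqk : (q.+1 * k = n + (q.+1 * k - n))%N by rewrite subnKC.
have lt_rk : (q.+1 * k - n < k)%N.
  by rewrite ltn_subLR // mulSnr ltn_add2r.
exists q.+1, (q.+1 * k - n)%N; split=> //.
rewrite (petit_hom_X_succ (petit_hom_X_exp lt_qk)) Eqk.
rewrite skew_rem_mono_XnsubC ?(ltn_trans lt_rk) //.
by rewrite -Eqk /alphas big_ord_recr.
Qed.

Let iter_b_unit r : iter r sigma b \is a GRing.unit.
Proof. by elim: r => //= r IHr; apply: rmorph_unit. Qed.

(** Below degree [2n] at most one reduction occurs, and it multiplies the coefficient by a unit, an
    iterate of [sigma] at [b]. *)
Lemma skew_rem_mono_inj a c j : (j < n + n)%N ->
  skew_rem f (mono a j) = skew_rem f (mono c j) -> a = c.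
Proof.
move=> lt_j2n; have [lt_jn|le_nj] := ltnP j n.
  by rewrite !skew_rem_mono_small // => /skew_mono_inj.
have lt_rn : (j - n < n)%N by rewrite ltn_subLR.
rewrite -(subnKC le_nj) !skew_rem_mono_XnsubC // => /skew_mono_inj.
exact/mulIr.
Qed.

Lemma petit_hom_dvdn_sigma_b : (m %| n)%N /\ sigma b = b.
Proof.
have [i [r [Eik lt_rk GXi]]] := petit_hom_X_wrap.
have lt_rn := ltn_trans lt_rk k_lt_n.
have reg_c : GRing.lreg (alphas i * iter r sigma b).
  by apply: lregM; [exact: alphas_reg | exact/mulrI].
have iter_ri := petit_hom_mono_iter lt_rn reg_c GXi.
split.
  have Ei : i = n + r %[mod m].
    by rewrite -Eik -modnMmr petit_hom_modn_k modnMmr muln1.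
  rewrite -(subn0 n) -eqn_mod_dvd // -(eqn_modDr r) add0n -Ei; apply/eqP/esym.
  exact/(eq_iter_aut_order r i sigma_inj sigma_order).
(* Before reduction the two sides have degree [r + k] and coefficients [alphas i.+1] times
   [sigma^r(b)] and [sigma^(r+1)(b)] respectively. *)
have : G (skewX sigma ^+ i * skewX sigma) = G (skewX sigma * skewX sigma ^+ i).
  by rewrite -exprS -exprSr.
move/(congr1 (@petit_val _ _ _)); rewrite !GM GXi GX !skew_monoM.
rewrite [(r + k)%N]addnC; move/skew_rem_mono_inj; rewrite -addSn.
have -> : (k + r < n + n)%N by rewrite -addnS leq_add // ltnW.
rewrite petit_hom_iter_k rmorphM mulrA -alphasSl mulrAC (iter_ri alpha).
have <- : alphas i.+1 = alphas i * iter i sigma alpha.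
  by rewrite /alphas big_ord_recr.
move/(_ isT)/alphas_reg; rewrite -iterS iterSr => /esym.
by elim: (r) => // l IHl /sigma_inj.
Qed.

End PetitHomNecessity.

Theorem corollary3p4 (S : comUnitRingType)
    (sigma : {rmorphism S -> S}) (sigma_bij : bijective sigma)
    (m : nat) (sigma_order : has_aut_order sigma m)
    (k n : nat) (k_gt0 : (1 <= k)%N) (k_lt_n : (k < n)%N)
    (b : S) (b_unit : b \is a GRing.unit)
    (alpha : S) (alpha_reg : GRing.lreg alpha)
    (tau : {rmorphism S -> S}) (tau_bij : bijective tau)
    (tau_sigma : forall s : S, tau (sigma s) = sigma (tau s)) :
  (exists G : skewpoly sigma -> petit (skewX sigma ^+ n - skewC sigma b),
    [/\ petit_ring_hom G,
        forall a : S, petit_val (G (skewC sigma a)) = skewC sigma (tau a),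
        petit_val (G (skewX sigma)) = skewC sigma alpha * skewX sigma ^+ k &
        forall s : S, s \in fixed_ring2 sigma tau ->
          petit_val (G (skewC sigma s)) = skewC sigma s])
  <->
  [/\ unit_of_subring (fixed_ring sigma) b,
      k = 1 %[mod m] &
      (m %| n)%N].
Proof.
have n_gt0 : (0 < n)%N by apply: leq_ltn_trans k_lt_n.
split=> [[G [G_hom GC GX _]] | [[/eqP sb _] Ek mn]].
  have Ek := petit_hom_modn_k sigma_bij sigma_order k_lt_n alpha_reg tau_bij
    tau_sigma G_hom GC GX.
  have [mn sb] := petit_hom_dvdn_sigma_b sigma_bij sigma_order k_gt0 k_lt_n
    b_unit alpha_reg tau_bij tau_sigma G_hom GC GX.
  split=> //; split; first exact/eqP.
  by exists b^-1; [rewrite inE rmorphV // sb | exact: mulrV].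
have sigma_inj := bij_inj sigma_bij.
have iter_n : iter n sigma =1 id.
  apply/(eq_iter_aut_order n 0 sigma_inj sigma_order).
  by rewrite mod0n (eqP mn).
have iter_k : iter k sigma =1 sigma.
  exact/(eq_iter_aut_order k 1 sigma_inj sigma_order).
set f := _ - _; have mon_f : skew_monic f by apply: skew_monic_XnsubC.
have comm_f : forall g, GRing.comm f g.
  (* Constants commute with [t^n] because [sigma^n] is the identity and with [b] because [S] is
     commutative; [t] commutes with [b] because [sigma b = b]. *)
  apply: skew_central => [a|]; apply/commr_sym/commrB.
  - rewrite /GRing.comm -skew_mono0 -skew_mono1 !skew_monoM iter_n.
    by rewrite addn0 add0n mulr1 mul1r.
  - by rewrite /GRing.comm -!skewCM mulrC.
  - exact: commrX.
  by rewrite /GRing.comm skew_commute sb.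
pose u := skew_mono sigma alpha k.
have u_tau a : u * skewC sigma (tau a) = skewC sigma (tau (sigma a)) * u.
  by rewrite -!skew_mono0 !skew_monoM iter_k tau_sigma addn0 add0n mulrC.
have evalC a : skew_eval tau u (skewC sigma a) = skewC sigma (tau a).
  by rewrite -[skewC sigma a]skew_mono0 skew_eval_mono mulr1.
have evalX : skew_eval tau u (skewX sigma) = u.
  rewrite -[skewX sigma]expr1 -skew_mono1 skew_eval_mono rmorph1 expr1.
  exact: mul1r.
have remC a : skew_rem f (skewC sigma a) = skewC sigma a.
  by rewrite -skew_mono0 skew_rem_mono_small.
exists (fun g => petit_mod f (skew_eval tau u g)); split=> [||| s].
- split=> [g h | g h |].
  + by apply: val_inj; rewrite /= skew_evalD skew_remD.
  + by rewrite skew_evalM // petit_modM.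
  by rewrite (evalC 1) rmorph1.
- by move=> a; rewrite /= evalC remC.
- by rewrite /= evalX skew_rem_mono_small.
by rewrite inE => /andP[_ /eqP tau_s]; rewrite /= evalC tau_s remC.
Qed.
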